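(* If $(X,d)$ is a metric space, then each lower semi-continuous function $\varphi:X\to\mathbb{R}$ is a pointwise limit of some increasing sequence of locally Lipschitz functions; that is, there are locally Lipschitz functions $f_n:X\to\mathbb{R}$, $n\in\mathbb{N}$, such that $f_n(x)\le f_{n+1}(x)$ for every $n\in\mathbb{N}$ and $x\in X$, and $\lim_{n\to\infty}f_n(x)=\varphi(x)$ for every $x\in X$.
   Context: A function $\varphi:X\to\mathbb{R}$ on a metric space is lower semi-continuous if $\varliminf_{x\to p}\varphi(x)\ge\varphi(p)$ for every $p\in X$, where $\varliminf_{x\to p}\varphi(x)=\sup_{\delta>0}\inf\varphi(\mathbf{O}(p,\delta))$ and $\mathbf{O}(p,\delta)=\{x\in X:d(x,p)<\delta\}$. A function $f:X\to\mathbb{R}$ is Lipschitz if there exists $K\ge 0$ such that $|f(p)-f(q)|\le K\,d(p,q)$ for all $p,q\in X$; it is locally Lipschitz if each point of $X$ is contained in an open set $U\subset X$ such that the restriction of $f$ to $U$ is Lipschitz. ''Increasing'' is understood in the non-strict sense. *)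

(* Defs.v *)
From HB Require Import structures.
From mathcomp Require Import all_boot all_order all_algebra.
From mathcomp Require Import all_classical all_reals.
From mathcomp Require Import ereal topology normedtype.
Set Implicit Arguments.
Unset Strict Implicit.
Unset Printing Implicit Defensive.
Import Order.TTheory GRing.Theory Num.Theory.
Import numFieldNormedType.Exports.
Local Open Scope classical_set_scope.
Local Open Scope ring_scope.

(* [ball p delta] is [set x | mdist p x < delta] (lemma [ballEmdist]).
   The balls are not punctured at [p] (unlike in the library's [lime_inf]).
   The value lies in the extended reals since [phi] may be unbounded below on
   every ball around [p]. *)
Definition metric_liminf (R : realType) (X : metricType R) (phi : X -> R)
    (p : X) : \bar R :=
  ereal_sup [set ereal_inf [set (phi x)%:E | x in ball p delta]
            | delta in [set delta : R | 0 < delta]].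

(* The library's [lower_semicontinuous] asks instead that
   [set x | a%:E < f x] be a neighbourhood of each of its points. *)
Definition metric_lsc (R : realType) (X : metricType R) (phi : X -> R) : Prop :=
  forall p : X, ((phi p)%:E <= metric_liminf phi p)%E.

(* The library's [lipschitz] notions require a normed module as domain.
   [metric_lipschitz U f] says that the restriction of [f] to [U] is
   Lipschitz. *)
Definition metric_lipschitz (R : realType) (X : metricType R) (U : set X)
    (f : X -> R) : Prop :=
  exists2 K : R, 0 <= K &
    forall p q : X, U p -> U q -> `|f p - f q| <= K * mdist p q.

Definition metric_locally_lipschitz (R : realType) (X : metricType R)
    (f : X -> R) : Prop :=
  forall p : X, exists U : set X, [/\ open U, U p & metric_lipschitz U f].

(* Main.v *)
(** The increasing homeomorphism [exp] from the line onto the positive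
    half-line turns [phi] into a positive lower semi-continuous function [psi],
    whose Lipschitz regularizations
    [psi_n x = inf_y (psi y + n * d(x, y))], [n > 0], increase to [psi].  Lower
    semi-continuity bounds [psi] away from [0] around each point, so that
    [psi_n > 0]; as [ln] is Lipschitz away from [0], the functions [ln (psi_n)]
    are locally Lipschitz, and they increase to [phi].  Thus no locally
    Lipschitz partition of unity (paracompactness) is needed, although [phi]
    may be unbounded below. *)
Require Import Defs.
From HB Require Import structures.
From mathcomp Require Import all_boot all_order all_algebra.
From mathcomp Require Import all_classical all_reals.
From mathcomp Require Import ereal topology normedtype.
From mathcomp Require Import sequences exp.
From mathcomp Require Import lra.
Set Implicit Arguments.
Unset Strict Implicit.
Unset Printing Implicit Defensive.
Import Order.TTheory GRing.Theory Num.Theory.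
Import numFieldNormedType.Exports.
Local Open Scope classical_set_scope.
Local Open Scope ring_scope.

Lemma metric_lsc_ball (R : realType) (X : metricType R) (phi : X -> R)
    (p : X) (b : R) : metric_lsc phi -> b < phi p ->
  exists2 delta : R, 0 < delta & forall q, mdist p q < delta -> b < phi q.
Proof.
move=> hphi bp.
have /ereal_sup_gt[_ [delta /= d0 <-] bd] : (b%:E < metric_liminf phi p)%E.
  by apply: lt_le_trans (hphi p); rewrite lte_fin.
exists delta => // q pq; rewrite -lte_fin; apply: (lt_le_trans bd).
by apply: ereal_inf_lbound; exists q => //; rewrite ballEmdist.
Qed.

(** The bound [ln (1 + u) <= u] at [u = s / t - 1] gives [(s - t) / t], and [t^-1 <= c^-1].
    Exchanging [s] and [t] yields the Lipschitz bound for [ln] above [c]. *)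
Lemma ler_ln_sub (R : realType) (c s t : R) : 0 < c -> 0 < s -> c <= t ->
  ln s - ln t <= c^-1 * `|s - t|.
Proof.
move=> c0 s0 ct; have t0 : 0 < t by exact: lt_le_trans ct.
rewrite -ln_div ?posrE//.
have -> : s / t = 1 + (s / t - 1) by rewrite addrC subrK.
apply: (le_trans (le_ln1Dx _)); first by have := divr_gt0 s0 t0; lra.
rewrite -[X in _ - X](divff (lt0r_neq0 t0)) -mulrBl mulrC.
apply: (@le_trans _ _ (t^-1 * `|s - t|)).
  by rewrite ler_wpM2l ?invr_ge0 ?ler_norm// ltW.
by rewrite ler_wpM2r// lef_pV2 ?posrE.
Qed.

Lemma locally_lipschitz_ln (R : realType) (X : metricType R) (g : X -> R) :
  (forall x, 0 < g x) -> metric_lipschitz setT g ->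
  metric_locally_lipschitz (fun x => ln (g x)).
Proof.
move=> g0 [K K0 gK] p.
have c0 : 0 < g p / 2 by rewrite divr_gt0.
(* On this ball [g] drops by at most [g p / 2]; [K + 1] keeps the radius positive when [K = 0]. *)
have r0 : 0 < g p / 2 / (K + 1) by rewrite divr_gt0// ltr_wpDl.
exists (ball p (g p / 2 / (K + 1)))°; split.
- exact: open_interior.
- exact: nbhsx_ballx.
have gc q : (ball p (g p / 2 / (K + 1)))° q -> g p / 2 <= g q.
  move=> /interior_subset; rewrite ballEmdist /= ltr_pdivlMr ?ltr_wpDl// => pq.
  have := gK p q I I; have := mdist_ge0 p q; have := ler_norm (g p - g q).
  by lra.
exists ((g p / 2)^-1 * K); first by rewrite mulr_ge0// invr_ge0 ltW.
move=> x y /gc gx /gc gy; rewrite -mulrA.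
apply: (@le_trans _ _ ((g p / 2)^-1 * `|g x - g y|)); last first.
  by rewrite ler_wpM2l ?gK// invr_ge0 ltW.
rewrite ler_norml lerNl opprB {1}distrC.
by rewrite !ler_ln_sub.
Qed.

Section lipschitz_regularization.
Context (R : realType) (X : metricType R) (psi : X -> R).
Hypothesis psi_ge0 : forall x, 0 <= psi x.

(** For [0 <= K] this is the Pasch-Hausdorff envelope, the largest [K]-Lipschitz minorant of [psi];
    [psi_ge0] makes the real [inf] a genuine infimum. *)
Definition lipschitz_reg (K : R) (x : X) : R :=
  inf [set psi y + K * mdist x y | y in setT].

Lemma lipschitz_reg_le (K : R) (x y : X) : 0 <= K ->
  lipschitz_reg K x <= psi y + K * mdist x y.
Proof.
move=> K0; apply: ge_inf; last by exists y.
by exists 0 => _ [z _ <-]; rewrite addr_ge0// mulr_ge0// mdist_ge0.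
Qed.

Lemma lipschitz_reg_ge (K : R) (x : X) (a : R) :
  (forall y, a <= psi y + K * mdist x y) -> a <= lipschitz_reg K x.
Proof.
move=> ha; apply: lb_le_inf; first by exists (psi x + K * mdist x x), x.
by move=> _ [y _ <-].
Qed.

Lemma lipschitz_reg_le_self (K : R) (x : X) : 0 <= K ->
  lipschitz_reg K x <= psi x.
Proof.
by move=> K0; have := lipschitz_reg_le x x K0; rewrite mdistxx mulr0 addr0.
Qed.

Lemma lipschitz_reg_nondecreasing (K L : R) (x : X) : 0 <= K -> K <= L ->
  lipschitz_reg K x <= lipschitz_reg L x.
Proof.
move=> K0 KL; apply: lipschitz_reg_ge => y.
apply: (le_trans (lipschitz_reg_le x y K0)).
by rewrite lerD2l ler_wpM2r// mdist_ge0.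
Qed.

Lemma lipschitz_reg_lipschitz (K : R) : 0 <= K ->
  metric_lipschitz setT (lipschitz_reg K).
Proof.
move=> K0; exists K => //.
have half p q : lipschitz_reg K p - lipschitz_reg K q <= K * mdist p q.
  rewrite lerBlDl -lerBlDr; apply: lipschitz_reg_ge => y.
  rewrite lerBlDr -addrA -mulrDr; apply: (le_trans (lipschitz_reg_le p y K0)).
  by rewrite lerD2l ler_wpM2l// addrC metric_triangle.
by move=> p q _ _; rewrite ler_norml lerNl opprB {1}metric_sym !half.
Qed.

(** Points [y] in the ball contribute at least [a]; those outside cost at least [K * delta], as
    [psi] is nonnegative. *)
Lemma lipschitz_reg_ge_ball (K a delta : R) (x : X) : 0 <= K ->
  (forall y, mdist x y < delta -> a <= psi y) ->
  Num.min a (K * delta) <= lipschitz_reg K x.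
Proof.
move=> K0 ha; apply: lipschitz_reg_ge => y; rewrite ge_min.
have [/ha ay|dy] := ltP (mdist x y) delta.
  by rewrite (le_trans ay)// lerDl mulr_ge0// mdist_ge0.
by rewrite orbC (le_trans (ler_wpM2l K0 dy))// lerDr.
Qed.

End lipschitz_regularization.

Theorem theorem5p1 (R : realType) (X : metricType R) (phi : X -> R)
  (hphi : metric_lsc phi) :
  exists f : nat -> X -> R,
    [/\ forall n : nat, metric_locally_lipschitz (f n),
        forall (n : nat) (x : X), f n x <= f n.+1 x
      & forall x : X, f n x @[n --> \oo] --> phi x].
Proof.
pose psi x := expR (phi x).
have psi0 x : 0 <= psi x by exact: expR_ge0.
(* Slopes start at 1, so that [g 0] is positive too. *)
pose g n := lipschitz_reg psi n.+1%:R.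
(* A single [delta] serves all [n]: [b = phi x - 1] will give positivity, [b = phi x - eps]
   convergence. *)
have g_ge x b : b < phi x -> exists2 delta : R, 0 < delta &
    forall n, Num.min (expR b) (n.+1%:R * delta) <= g n x.
  move=> /(metric_lsc_ball hphi)[delta d0 hd]; exists delta => // n.
  by apply: lipschitz_reg_ge_ball => // y /hd /ltW; rewrite ler_expR.
have g_gt0 n x : 0 < g n x.
  have [|delta d0 hg] := g_ge x (phi x - 1); first by rewrite ltrBlDr ltrDl.
  by apply: lt_le_trans (hg n); rewrite lt_min expR_gt0 mulr_gt0.
exists (fun n x => ln (g n x)); split.
- by move=> n; apply: locally_lipschitz_ln => //; exact: lipschitz_reg_lipschitz.
- move=> n x; rewrite ler_ln ?posrE//.
  by apply: lipschitz_reg_nondecreasing; rewrite ?ler_nat.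
move=> x; apply/cvgrPdist_le => eps eps0.
have [|delta d0 hg] := g_ge x (phi x - eps); first by rewrite ltrBlDr ltrDl.
near=> n.
have gphi : ln (g n x) <= phi x.
  by rewrite -[leRHS]expRK ler_ln ?posrE ?expR_gt0// lipschitz_reg_le_self.
rewrite ger0_norm ?subr_ge0// lerBlDr -lerBlDl.
rewrite -[leLHS]expRK ler_ln ?posrE ?expR_gt0//.
(* Once [n >= expR (phi x - eps) / delta], the minimum is [expR (phi x - eps)]. *)
apply: le_trans (hg n); rewrite le_min lexx /= -ler_pdivrMr//.
apply: (@le_trans _ _ n%:R); last by rewrite ler_nat.
by near: n; exact: nbhs_infty_ger.
Unshelve. all: by end_near.
Qed.
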